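(* Let $W$ be a finite group acting orthogonally on a Euclidean vector space $\mathfrak{t}$, preserving a lattice $\Gamma$ in $\mathfrak{t}$, and let $w\in W$ with centraliser $Z_W(w)$. The actions of $Z_W(w)$ on $F_w$ and $F_w^\vee$ are dual, that is, $$\langle gs,gt\rangle^w=\langle s,t\rangle^w\qquad\text{for all } s\in F_w,\ t\in F_w^\vee,\ g\in Z_W(w),$$ where $\langle-,-\rangle^w$ is the canonical circle-valued pairing between $F_w$ and $F_w^\vee$.
   Context: $\mathfrak{t}$ is a finite-dimensional real inner product space and $\Gamma$ is a full-rank lattice in it. The dual lattice is $\Gamma^\vee=\{x\in\mathfrak{t} : \langle x,y\rangle\in\mathbb{Z}\ \text{for all } y\in\Gamma\}$, which is preserved by $W$. Let $\mathcal{T}=\mathfrak{t}/\Gamma$ and $\mathcal{T}^\vee=\mathfrak{t}/\Gamma^\vee$, with the induced $W$-actions. $\mathcal{T}^w$ and $(\mathcal{T}^\vee)^w$ denote the subgroups of points fixed by $w$, and $\mathcal{T}^w_1$, $(\mathcal{T}^\vee)^w_1$ their identity components. The component groups are the finite abelian groups $F_w=\mathcal{T}^w/\mathcal{T}^w_1$ and $F_w^\vee=(\mathcal{T}^\vee)^w/(\mathcal{T}^\vee)^w_1$. The centraliser $Z_W(w)$ preserves the $w$-fixed sets and hence acts on $F_w$ and $F_w^\vee$ by automorphisms. Hats denote Pontryagin duals. The pairing $\langle-,-\rangle^w$ is defined as follows. Let $\mathfrak{t}^w=\ker(I-w)$ and $\mathfrak{x}_w=(\mathfrak{t}^w)^\perp$.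 Restricting the characters $\chi_x(y+\Gamma)=e^{2\pi i\langle x,y\rangle}$, $x\in\Gamma^\vee$, of $\mathcal{T}$ identifies $\widehat{F_w}$ with $(\mathfrak{x}_w\cap\Gamma^\vee)/(I-w)\Gamma^\vee$; likewise, using characters $x+\Gamma^\vee\mapsto e^{2\pi i\langle x,y\rangle}$, $y\in\Gamma$, of $\mathcal{T}^\vee$, $\widehat{F_w^\vee}$ is identified with $(\mathfrak{x}_w\cap\Gamma)/(I-w)\Gamma$. Let $m$ be the minimal polynomial of $w$ on $\mathfrak{t}$, $\dot m(t)=\frac{m(t)-m(1)}{t-1}$, and, when $m(1)=0$, $\ddot m(t)=\frac{\dot m(t)-\dot m(1)}{t-1}$. Put $\overline m=\dot m$, $\mu=m(1)$ if $m(1)\ne0$, and $\overline m=\ddot m$, $\mu=\dot m(1)$ if $m(1)=0$. The circle-valued pairing $\chi(x+(I-w)\Gamma^\vee,\,y+(I-w)\Gamma)=e^{\frac{2\pi i}{\mu}\langle x,\overline m(w)y\rangle}$ on $\widehat{F_w}\times\widehat{F_w^\vee}$ is well defined and non-degenerate and so induces an isomorphism $\widehat{\widehat{F_w^\vee}}\cong\widehat{F_w}$. Composing with the evaluation isomorphism gives $F_w^\vee\cong\widehat{\widehat{F_w^\vee}}\cong\widehat{F_w}$, $t\mapsto\psi_t$, and one sets $\langle s,t\rangle^w=\psi_t(s)$. *)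

(* Defs.v *)
From HB Require Import structures.
From mathcomp Require Import all_boot all_order all_algebra all_fingroup.
From mathcomp Require Import generic_quotient sesquilinear complex.
From mathcomp Require Import all_classical all_reals all_analysis.

Set Implicit Arguments.
Unset Strict Implicit.
Unset Printing Implicit Defensive.

Import Order.TTheory GRing.Theory Num.Theory.
Import numFieldNormedType.Exports.
Local Open Scope classical_set_scope.
Local Open Scope ring_scope.
Local Open Scope quotient_scope.

(** A Euclidean space is a finite-dimensional normed space with a positive
    definite symmetric form [dot : {dot V for idfun}] whose norm is the norm of
    [V]; the latter condition is a hypothesis of the theorem. *)
#[short(type="finNormedModType")]
HB.structure Definition FinNormedModule (R : realType) :=
  {V of NormedModule R V & Vector R V}.

Section Circle.
Variable R : realType.

Definition cis (x : R) : R[i] := (cos (2 * pi * x) +i* sin (2 * pi * x))%C.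

(** Only finite (discrete) groups [A] occur below, so the Pontryagin dual
    involves no continuity condition. *)
Record dual (A : zmodType) := Dual {
  dual_fun :> A -> R[i];
  dual_norm : forall a, `|dual_fun a| = 1;
  dualD : forall a b, dual_fun (a + b) = dual_fun a * dual_fun b }.

HB.instance Definition _ A := gen_eqMixin (dual A).
HB.instance Definition _ A := gen_choiceMixin (dual A).

Definition dual1 (A : zmodType) : dual A :=
  @Dual A (fun=> 1) (fun=> normr1 _) (fun _ _ => esym (mul1r 1)).

End Circle.

Section MinimalPolynomial.
Variables (R : realType) (V : vectType R).
Implicit Types (f : 'End(V)) (p m : {poly R}).

Definition horner_end p f (v : V) : V := \sum_(i < size p) p`_i *: iter i f v.

Definition annihilates p f := forall v, horner_end p f v = 0.

Definition is_minpoly f m :=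
  [/\ m \is monic, annihilates m f &
      forall p, p != 0 -> annihilates p f -> (size m <= size p)%N].

(** [mxminpoly] is only available in dimension at least [1]. *)
Definition minpoly f : {poly R} := xget 0 [set m | is_minpoly f m].

(** The division is exact, the dividend being zero at [1]. *)
Definition quotX1 p : {poly R} := (p - p.[1]%:P) %/ ('X - 1%:P).

Definition mbar f : {poly R} :=
  let m := minpoly f in
  if m.[1] != 0 then quotX1 m else quotX1 (quotX1 m).

Definition mu f : R :=
  let m := minpoly f in if m.[1] != 0 then m.[1] else (quotX1 m).[1].

End MinimalPolynomial.

Section Lattice.
Variables (R : realType) (V : finNormedModType R) (dot : {dot V for idfun}).

Definition is_lattice (L : {pred V}) :=
  exists2 b : (\dim {:V}).-tuple V, basis_of {:V} b &
    forall x, x \in L <->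
      exists z : 'I_(\dim {:V}) -> int, x = \sum_i tnth b i *~ z i.

Definition dual_lattice (L : {pred V}) : {pred V} :=
  fun x => `[< forall y, y \in L -> dot x y \is a Num.int >].

Fact dual_lattice_zmod L : zmod_closed (dual_lattice L).
Proof.
split=> [|x y /asboolP hx /asboolP hy]; apply/asboolP=> z zL.
  by rewrite linear0l rpred0.
by rewrite linearBl rpredB ?hx ?hy.
Qed.
HB.instance Definition _ L :=
  GRing.isZmodClosed.Build V (dual_lattice L) (dual_lattice_zmod L).

End Lattice.

Section OrthogonalAction.
Variables (R : realType) (V : finNormedModType R) (dot : {dot V for idfun}).
Variable W : finGroupType.

Record orth_action := OrthAction {
  oact :> W -> 'End(V);
  oact1 : oact 1%g = \1%VF;
  oactM : forall g h, oact (g * h)%g = (oact g \o oact h)%VF;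
  oact_dot : forall g x y, dot (oact g x) (oact g y) = dot x y }.

Definition preserves (rho : orth_action) (L : {pred V}) :=
  forall g x, x \in L -> rho g x \in L.

Lemma preserves_dual rho L :
  preserves rho L -> preserves rho (dual_lattice dot L).
Proof.
move=> rhoL g x /asboolP xL; apply/asboolP => y yL.
rewrite -(oact_dot rho g^-1%g) -comp_lfunE -oactM mulVg oact1 id_lfunE.
exact/xL/rhoL.
Qed.

End OrthogonalAction.

Section Torus.
Variables (R : realType) (V : finNormedModType R).

Definition torus (L : zmodClosed V) : zmodType := Quotient.quot L.

(** The carrier of [torus L] with the quotient topology; kept apart because
    [quotient_topology] comes with its own [Choice] structure, different from
    the one under the group structure of [torus L]. *)
Definition torus_top (L : zmodClosed V) : topologicalType :=
  quotient_topology (Quotient.quot L).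

Definition to_torus (L : zmodClosed V) (v : V) : torus L :=
  \pi_(Quotient.quot L) v.

(** For [f] preserving [L], this is [v + L |-> f v + L]. *)
Definition torus_map (L : zmodClosed V) (f : 'End(V)) (p : torus L) : torus L :=
  to_torus L (f (repr (p : Quotient.quot L))).

Section TorusTheory.
Variable L : zmodClosed V.

Lemma to_torusD : {morph to_torus L : u v / u + v}.
Proof. by move=> u v; exact (@Quotient.pi_add V L u v). Qed.

Lemma to_torusB : {morph to_torus L : u v / u - v}.
Proof.
move=> u v; rewrite to_torusD; congr (_ + _); exact (@Quotient.pi_opp V L v).
Qed.

Lemma to_torus_eq u v : to_torus L u = to_torus L v <-> u - v \in L.
Proof. by rewrite Quotient.idealrBE; split=> [?|/eqP]; first exact/eqP. Qed.

Lemma to_torusP (p : torus L) : exists v, p = to_torus L v.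
Proof. by exists (repr (p : Quotient.quot L)); rewrite /to_torus reprK. Qed.

Lemma torus_mapE (f : 'End(V)) v : (forall x, x \in L -> f x \in L) ->
  torus_map f (to_torus L v) = to_torus L (f v).
Proof.
move=> fL; apply/to_torus_eq; rewrite -linearB; apply/fL/to_torus_eq.
by rewrite /to_torus reprK.
Qed.

Lemma torus_mapB (f : 'End(V)) : (forall x, x \in L -> f x \in L) ->
  {morph @torus_map L f : p q / p - q}.
Proof.
move=> fL p q; have [u ->] := to_torusP p; have [v ->] := to_torusP q.
by rewrite -to_torusB !torus_mapE // linearB to_torusB.
Qed.

Lemma to_torus_continuous : continuous (to_torus L : V -> torus_top L).
Proof. exact: (@pi_continuous _ (Quotient.quot L)). Qed.

Lemma torus_map_continuous (f : 'End(V)) : (forall x, x \in L -> f x \in L) ->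
  continuous f -> continuous (@torus_map L f : torus_top L -> torus_top L).
Proof.
move=> fL cf; apply/(@quotient_continuous _ (Quotient.quot L)).
rewrite (_ : _ \o _ = to_torus L \o f); last first.
  by apply/funext => v /=; exact: torus_mapE.
by move=> x; apply: continuous_comp; [exact: cf | exact: to_torus_continuous].
Qed.

Lemma torus_translate_continuous (q : torus L) :
  continuous ((fun p : torus L => p - q) : torus_top L -> torus_top L).
Proof.
have [v ->] := to_torusP q.
apply/(@quotient_continuous _ (Quotient.quot L)).
rewrite (_ : _ \o _ = to_torus L \o (fun u => u - v)); last first.
  by apply/funext => u /=; rewrite to_torusB.
move=> x; apply: continuous_comp; last exact: to_torus_continuous.
by apply: cvgB; [exact: cvg_id | exact: cvg_cst].
Qed.

End TorusTheory.
End Torus.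

Section ComponentGroup.
Variables (R : realType) (V : finNormedModType R) (dot : {dot V for idfun}).
Variables (W : finGroupType) (rho : orth_action dot W).
Variables (L : zmodClosed V) (rhoL : preserves rho L).

Section Fixed.
Variable w : W.

(** The proof [rhoL] is an argument because these sets are subgroups only if the
    action preserves [L]. *)
Definition fixed_pts of preserves rho L : {pred torus L} :=
  fun p => torus_map (rho w) p == p.

Fact fixed_pts_zmod : zmod_closed (fixed_pts rhoL).
Proof.
split=> [|p q /eqP hp /eqP hq]; last first.
  by apply/eqP; rewrite torus_mapB ?hp ?hq //; exact: rhoL.
rewrite unfold_in -{1}(subrr (0 : torus L)) torus_mapB ?subrr //.
exact: rhoL.
Qed.
HB.instance Definition _ :=
  GRing.isZmodClosed.Build (torus L) (fixed_pts rhoL) fixed_pts_zmod.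

Record fixed_torus := FixedTorus {
  ft_val : torus L;
  _ : ft_val \in fixed_pts rhoL }.
HB.instance Definition _ := [isSub for ft_val].
HB.instance Definition _ := [Choice of fixed_torus by <:].
HB.instance Definition _ := [SubChoice_isSubZmodule of fixed_torus by <:].

Definition identity_component : {pred fixed_torus} :=
  fun p => `[< connected_component
    ([set q | q \in fixed_pts rhoL] : set (torus_top L)) (0 : torus L)
    (val p) >].

Fact identity_component_zmod : zmod_closed identity_component.
Proof.
split=> [|p q /asboolP hp /asboolP hq]; apply/asboolP.
  by apply: connected_component_refl; exact: rpred0.
set A : set (torus_top L) := [set q | _] in hp hq *.
pose C := connected_component A (0 : torus L).
pose h : torus_top L -> torus_top L := fun x : torus L => x - val q.
have hC : connected (h @` C).
  apply: connected_continuous_connected; first exact: component_connected.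
  by apply: continuous_subspaceT; exact: torus_translate_continuous.
exists (h @` C); last by exists (val p).
split=> //; first by exists (val q); rewrite // /h subrr.
by move=> _ [x /connected_component_sub Ax <-]; apply: rpredB => //; exact: valP q.
Qed.
HB.instance Definition _ :=
  GRing.isZmodClosed.Build fixed_torus identity_component
    identity_component_zmod.

Definition component_group : zmodType := Quotient.quot identity_component.

Definition to_component (p : fixed_torus) : component_group :=
  \pi_(Quotient.quot identity_component) p.

End Fixed.

Section CentraliserAction.
Variables g w : W.
Hypothesis gw : g \in 'C[w]%g.

Fact fixed_torus_act_subproof (p : fixed_torus w) :
  torus_map (rho g) (val p) \in fixed_pts w rhoL.
Proof.
case: p => /= p; have [v ->] := to_torusP p; rewrite !unfold_in => /eqP.
rewrite !torus_mapE; try exact: rhoL; move=> hv.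
rewrite -comp_lfunE -oactM -(cent1P gw) oactM comp_lfunE.
by rewrite -torus_mapE ?hv ?torus_mapE //; exact: rhoL.
Qed.

Definition fixed_torus_act (p : fixed_torus w) : fixed_torus w :=
  FixedTorus (fixed_torus_act_subproof p).

(** By [component_actE], this is the map induced by [fixed_torus_act]. *)
Definition component_act (s : component_group w) : component_group w :=
  to_component (fixed_torus_act
    (repr (s : Quotient.quot (@identity_component w)))).

Lemma fixed_torus_actB : {morph fixed_torus_act : p q / p - q}.
Proof.
move=> p q; apply: val_inj; rewrite [RHS]raddfB /=.
transitivity (torus_map (rho g) (val p - val q)); last first.
  by rewrite torus_mapB //; exact: rhoL.
by congr torus_map; exact: raddfB.
Qed.

Hypothesis dotE : forall x, dot x x = `|x| ^+ 2.

Lemma oact_continuous : continuous (rho g : V -> V).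
Proof.
have rhoN v : `|rho g v| = `|v|.
  by apply/eqP; rewrite -(@eqrXn2 _ 2) // -!dotE oact_dot.
move=> x; apply/cvgrPdist_lt => e e0; near=> y.
rewrite -linearB rhoN; near: y.
by move: e e0; apply/cvgrPdist_lt; exact: cvg_id.
Unshelve. all: by end_near. Qed.

Lemma component_actE p :
  component_act (to_component p) = to_component (fixed_torus_act p).
Proof.
apply/eqP; rewrite -Quotient.idealrBE -fixed_torus_actB.
set q := repr _; have : q - p \in @identity_component w.
  by rewrite Quotient.idealrBE reprK.
move: (q - p) => {q p} p /asboolP hp; apply/asboolP.
set A : set (torus_top L) := [set q | _] in hp *.
pose C := connected_component A (0 : torus L).
pose h : torus_top L -> torus_top L := @torus_map R V L (rho g).
have gL x : x \in L -> rho g x \in L by exact: rhoL.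
have hC : connected (h @` C).
  apply: connected_continuous_connected; first exact: component_connected.
  apply: continuous_subspaceT; apply: torus_map_continuous => //.
  exact: oact_continuous.
exists (h @` C); last by exists (val p).
split=> //.
  exists (0 : torus L); last by rewrite /h -(subrr (0 : torus L)) torus_mapB ?subrr.
  by apply: connected_component_refl; exact: rpred0.
move=> _ [x /connected_component_sub Ax <-].
exact: (fixed_torus_act_subproof (FixedTorus Ax)).
Qed.

End CentraliserAction.
End ComponentGroup.

Section Pairing.
Variables (R : realType) (V : finNormedModType R) (dot : {dot V for idfun}).
Variables (W : finGroupType) (rho : orth_action dot W).

(** [x] represents [a] when the inflation of [a] along
    [fixed_torus -> component_group] is the restriction of the character
    [v + L |-> cis (dot x v)] of the torus. *)
Definition represents (L : zmodClosed V) (rhoL : preserves rho L) (w : W)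
    (x : V) (a : dual R (component_group rhoL w)) :=
  forall (p : fixed_torus rhoL w) (v : V),
    val p = to_torus L v -> a (to_component p) = cis (dot x v).

Definition moved_space (w : W) : {vspace V} :=
  orthov dot (lker (\1%VF - rho w)).

(** A representative in [L'] of the coset attached to the character [a] of
    [component_group rhoL w]; here [L] and [L'] are dual to each other. *)
Definition char_rep (L L' : zmodClosed V) (rhoL : preserves rho L) (w : W)
    (a : dual R (component_group rhoL w)) : V :=
  xget 0 [set x | [/\ x \in moved_space w, x \in L' & represents x a]].

Variables (Gamma : zmodClosed V) (rhoG : preserves rho Gamma) (w : W).

Local Notation Gamma' := (dual_lattice dot Gamma).
Local Notation F := (component_group rhoG w).
Local Notation F' := (component_group (preserves_dual rhoG) w).

Definition chi (a : dual R F) (b : dual R F') : R[i] :=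
  let x := char_rep Gamma' a in
  let y := char_rep Gamma b in
  cis ((mu (rho w))^-1 * dot x (horner_end (mbar (rho w)) (rho w) y)).

(** The image of [t] under [F' ~ dual (dual F') ~ dual F], that is the preimage
    of the evaluation at [t] under the isomorphism [a |-> chi a -]. *)
Definition psi (t : F') : dual R F :=
  xget (dual1 R F) [set a | forall b, chi a b = b t].

Definition pairing (s : F) (t : F') : R[i] := psi t s.

End Pairing.

(* Main.v *)
Require Import Defs.
From HB Require Import structures.
From mathcomp Require Import all_boot all_order all_algebra all_fingroup.
From mathcomp Require Import generic_quotient sesquilinear complex.
From mathcomp Require Import all_classical all_reals all_analysis.
From mathcomp Require Import ring lra.

Set Implicit Arguments.
Unset Strict Implicit.
Unset Printing Implicit Defensive.

Import Order.TTheory GRing.Theory Num.Theory.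
Import numFieldNormedType.Exports.
Local Open Scope classical_set_scope.
Local Open Scope ring_scope.

(** Write [A] for [rho w].  On the moved space, the orthogonal complement of the
    fixed space of [A], the endomorphism [1 - A] is invertible, and the
    polynomial recipe [mu^-1 * mbar (A)] is nothing but its inverse
    ([moved_invP]).  A point [v + L] of the torus of [L] is fixed by [w] exactly
    when [v - A v] lies in [L]; hence if [y] in the moved space represents a
    character [b] of the dual component group, then [u = (1 - A)^-1 y] defines a
    fixed point of the torus of [Gamma], and [chi a b] is simply the value of
    [a] at the class of [u] ([chiE]).

    The preimage of the evaluation at the class of [v] can therefore be written
    down: it is the character represented by [v - A^-1 v].  This gives the
    closed formula [pairingE]: the pairing of the classes of [u] and [v] is
    [cis (dot (u - A u) v)].  The formula involves only the inner product and
    [A], so it is invariant under any isometry commuting with [A], which is the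
    theorem.

    Two facts make the formula legitimate.  First, a vector of the moved space
    that is integral on [L] does define a character of the component group
    ([character_of_vector]): on the fixed points its values are roots of unity
    of order dividing that of [w], so it is constant on the identity component,
    which is connected.  Secondly, every character of the component group
    arises in this way ([vector_of_character]).  Transported by [1 - A], it
    becomes a character of the lattice vectors of the moved space; such a
    character is [cis (dot z y)] for some [z], because the circle is divisible
    ([character_linear]), and then [z - A^-1 z] represents the given one.  Both
    facts are needed for [Gamma] and for its dual, whence the symmetric notion
    [dual_pair].  The second one is also what makes [psi] unambiguous: a
    character without representative would be paired trivially with
    everything. *)

(** * Characters of the real line *)

Section Cis.
Variable R : realType.
Implicit Types x y : R.

Lemma cis0 : cis 0 = 1 :> R[i].
Proof. by rewrite /cis mulr0 cos0 sin0. Qed.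

Lemma cisD x y : cis (x + y) = cis x * cis y.
Proof.
by rewrite /cis mulrDr cosD sinD /GRing.mul /= addrC [X in (_ +i* X)%C]addrC.
Qed.

Lemma normr_cis x : `|cis x| = 1.
Proof. by rewrite normc_def /= cos2Dsin2 sqrtr1. Qed.

Lemma cis_neq0 x : cis x != 0.
Proof. by rewrite -normr_eq0 normr_cis oner_eq0. Qed.

Lemma cisMn x n : cis (x *+ n) = cis x ^+ n.
Proof.
elim: n => [|n IH]; first by rewrite mulr0n cis0 expr0.
by rewrite mulrS cisD IH exprS.
Qed.

Lemma cis_eq1 x : cis x = 1 <-> x \is a Num.int.
Proof.
have cis_int m : cis m%:~R = 1 :> R[i].
  have nat1 n : cis n%:R = 1 :> R[i].
    by rewrite cisMn /cis mulr1 mulr_natl cos2pi sin2pi expr1n.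
  case: m => n; first exact: nat1.
  apply: (mulfI (cis_neq0 n.+1%:R)).
  by rewrite -cisD NegzE mulrNz subrr cis0 nat1 mulr1.
split=> [xE|/intrP[m ->]]; last exact: cis_int.
have /andP[le_fl lt_fl] := floor_itv x.
set f : R := x - (Num.floor x)%:~R.
have f_ge0 : 0 <= f by rewrite subr_ge0.
have f_lt1 : f < 1 by rewrite ltrBlDl -[1]/(1%:~R) -intrD.
have fE : cis f = 1.
  apply: (mulIf (cis_neq0 (Num.floor x)%:~R)).
  by rewrite -cisD subrK xE cis_int mulr1.
have [f0|f_neq0] := eqVneq f 0.
  by rewrite -(subrK (Num.floor x)%:~R x) -/f f0 add0r intr_int.
have f_gt0 : 0 < f by rewrite lt_def f_neq0.
(* 1 - cos (2 pi f) is twice the square of sin (pi f), positive on ]0, 1[ *)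
have sin_gt0 : 0 < sin (pi * f).
  by apply: sin_gt0_pi; rewrite mulr_gt0 ?pi_gt0 //= gtr_pMr ?pi_gt0.
move: fE => [+ _]; rewrite -mulrA mulr_natl cos_mulr2n cos2sin2 => cosE.
move: (exprn_gt0 2 sin_gt0) cosE; set s := _ ^+ 2 => s_gt0 sE.
by move: s_gt0; rewrite (_ : s = 0) ?ltxx //; move: sE {xE}; lra.
Qed.

Lemma cis_surj (z : R[i]) : `|z| = 1 -> exists x, z = cis x.
Proof.
case: z => a b; rewrite normc_def /= => -[] /(congr1 (fun x => x ^+ 2)).
rewrite expr1n sqr_sqrtr ?addr_ge0 ?sqr_ge0 // => abE.
have a1 : -1 <= a <= 1.
  rewrite -ler_norml -(@ler_pXn2r _ 2) ?nnegrE //.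
  by rewrite expr1n -abE real_normK ?num_real // lerDl sqr_ge0.
have sinE : sin (acos a) = `|b|.
  by rewrite sin_acos // -abE addrAC subrr add0r sqrtr_sqr.
have pi2 : 2 * pi != 0 :> R by rewrite mulf_neq0 ?pnatr_eq0 // gt_eqF ?pi_gt0.
exists ((if 0 <= b then acos a else - acos a) / (2 * pi)).
rewrite /cis mulrC divfK //; case: ifPn => [b0|].
  by rewrite acosK ?in_itv //= sinE ger0_norm.
rewrite -ltNge cosN sinN acosK ?in_itv //= sinE => /ltr0_norm ->.
by rewrite opprK.
Qed.

(** A root of unity other than [1] has vanishing power sum, so the real part of
    this sum is a continuous function separating integers from the other
    multiples of [1 / n]. *)
Lemma sum_cis n x : x *+ n \is a Num.int -> x \isn't a Num.int ->
  \sum_(j < n) cis (x *+ j) = 0.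
Proof.
move=> /cis_eq1 nx /negP xNint.
have x1 : cis x - 1 != 0.
  by rewrite subr_eq0; apply/eqP => /cis_eq1.
apply: (mulfI x1); rewrite mulr0.
under eq_bigr do rewrite cisMn.
by rewrite -subrX1 -cisMn nx subrr.
Qed.

Lemma continuous_sum_cos n :
  continuous (fun r : R => \sum_(j < n) cos (2 * pi * (r *+ j))).
Proof.
elim: n => [|n IH] r.
  rewrite (_ : (fun _ => _) = cst 0); first exact: cvg_cst.
  by apply/funext => ?; rewrite big_ord0.
rewrite (_ : (fun _ => _) = (fun r => \sum_(j < n) cos (2 * pi * (r *+ j))) \+
  (cos \o (fun r => 2 * pi * (r *+ n)))); last first.
  by apply/funext => ?; rewrite big_ord_recr.
apply: cvgD; first exact: IH.
apply: continuous_comp; last exact: continuous_cos.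
by apply: cvgMl_tmp; apply: cvgMn; exact: cvg_id.
Qed.

End Cis.

(** * Polynomials in an endomorphism *)

Section PolynomialOfEndomorphism.
Variables (R : realType) (V : vectType R) (f : 'End(V)).
Implicit Types (p q m : {poly R}) (v : V).

Lemma horner_end_widen n p v : (size p <= n)%N ->
  horner_end p f v = \sum_(i < n) p`_i *: iter i f v.
Proof.
move=> pn; rewrite /horner_end.
rewrite (big_ord_widen n (fun i => p`_i *: iter i f v)) //.
rewrite big_mkcond /=; apply: eq_bigr => i _; case: ltnP => // ?.
by rewrite nth_default // scale0r.
Qed.

Lemma horner_endD p q v :
  horner_end (p + q) f v = horner_end p f v + horner_end q f v.
Proof.
set n := maxn (size p) (size q).
rewrite !(@horner_end_widen n) ?leq_maxl ?leq_maxr ?size_polyD // -big_split /=.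
by apply: eq_bigr => i _; rewrite coefD scalerDl.
Qed.

Lemma horner_endZ a p v : horner_end (a *: p) f v = a *: horner_end p f v.
Proof.
rewrite (@horner_end_widen (size p)) ?size_scale_leq // scaler_sumr.
by apply: eq_bigr => i _; rewrite coefZ scalerA.
Qed.

Lemma horner_endC a v : horner_end a%:P f v = a *: v.
Proof.
by rewrite (@horner_end_widen 1) ?size_polyC_leq1 // big_ord1 coefC.
Qed.

Lemma horner_endMX p v : horner_end (p * 'X) f v = f (horner_end p f v).
Proof.
rewrite (@horner_end_widen (size p).+1); last first.
  by rewrite (leq_trans (size_polyMleq _ _)) // size_polyX addn2.
rewrite big_ord_recl coefMX scale0r add0r linear_sum.
by apply: eq_bigr => i _; rewrite coefMX linearZ.
Qed.

Lemma horner_end_divX1 p v :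
  horner_end p f v =
    f (horner_end (quotX1 p) f v) - horner_end (quotX1 p) f v + p.[1] *: v.
Proof.
have pE : p = quotX1 p * 'X + (- 1) *: quotX1 p + p.[1]%:P.
  rewrite scaleN1r -[X in _ - X]mulr1 -mulrBr -[1 in X in _ * X]polyC1.
  by rewrite divpK ?subrK // dvdp_XsubCl /root !hornerE subrr.
by rewrite {1}pE !horner_endD horner_endMX horner_endZ horner_endC scaleN1r.
Qed.

Lemma iter_linear n : linear (iter n f).
Proof. by elim: n => // n IH a u v; rewrite !iterS IH linearP. Qed.

Lemma horner_end_linear p : linear (horner_end p f).
Proof.
move=> a u v; rewrite /horner_end scaler_sumr -big_split /=.
by apply: eq_bigr => i _; rewrite iter_linear scalerDr !scalerA mulrC.
Qed.

Lemma minpolyP p : p != 0 -> annihilates p f -> is_minpoly f (minpoly f).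
Proof.
move=> p0 pf.
pose P n := `[< exists q, [/\ q != 0, annihilates q f & size q = n] >].
have exP : exists n, P n by exists (size p); apply/asboolP; exists p.
have [_ /asboolP[q [q0 qf <-]] q_min] := ex_minnP exP.
apply: xgetPex; exists ((lead_coef q)^-1 *: q); split.
- by rewrite monicE lead_coefZ mulVf ?lead_coef_eq0.
- by move=> v; rewrite horner_endZ qf scaler0.
- move=> r r0 rf; rewrite size_scale ?invr_eq0 ?lead_coef_eq0 //.
  by apply: q_min; apply/asboolP; exists r.
Qed.

End PolynomialOfEndomorphism.

(** * Inverting [1 - w] on the moved space *)

Section MovedSpace.
Variables (R : realType) (V : finNormedModType R) (dot : {dot V for idfun}).
Variables (W : finGroupType) (rho : orth_action dot W).
Implicit Types (g w : W) (u v x y : V).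

Lemma dotC x y : dot x y = dot y x.
Proof. by rewrite hermC expr0 mul1r. Qed.

Lemma dot_eq0 x : dot x x = 0 -> x = 0.
Proof.
move=> xx0; apply: contraTeq isT => /(neq0_dnorm_gt0 (s := dot)).
by rewrite xx0 ltxx.
Qed.

Lemma oactK g : cancel (rho g) (rho g^-1%g).
Proof. by move=> v; rewrite -comp_lfunE -oactM mulVg oact1 id_lfunE. Qed.

Lemma oactVK g : cancel (rho g^-1%g) (rho g).
Proof. by move=> v; rewrite -comp_lfunE -oactM mulgV oact1 id_lfunE. Qed.

Lemma oact_adj g x y : dot (rho g x) y = dot x (rho g^-1%g y).
Proof. by rewrite -(oact_dot rho g x) oactVK. Qed.

Lemma oactX g n v : rho (g ^+ n)%g v = iter n (rho g) v.
Proof.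
elim: n => [|n IH]; first by rewrite expg0 oact1 id_lfunE.
by rewrite expgS oactM comp_lfunE IH.
Qed.

Lemma fixedE w v : (v \in lker (\1%VF - rho w)) = (rho w v == v).
Proof. by rewrite memv_ker !lfunE /= !lfunE subr_eq0 eq_sym. Qed.

Lemma moved_fixed0 w v : v \in moved_space rho w -> rho w v = v -> v = 0.
Proof.
move=> /mem_orthovP v_moved /eqP; rewrite -fixedE => /v_moved.
exact: dot_eq0.
Qed.

Lemma coboundary_moved w u : u - rho w u \in moved_space rho w.
Proof.
apply/mem_orthovP => v; rewrite fixedE => /eqP vE.
by rewrite linearBl /= oact_adj -{2}vE oactK subrr.
Qed.

Lemma coboundaryV_moved w u : u - rho w^-1%g u \in moved_space rho w.
Proof.
rewrite -[u in u - _](oactVK w) -opprB rpredN; exact: coboundary_moved.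
Qed.

Lemma annihilates_order w : annihilates ('X^#[w]%g - 1) (rho w).
Proof.
move=> v; rewrite horner_endD -(polyCN 1) horner_endC scaleN1r.
rewrite (@horner_end_widen _ _ _ #[w]%g.+1) ?size_polyXn // (bigD1 ord_max) //=.
rewrite coefXn eqxx scale1r big1 ?addr0 => [|i]; last first.
  by rewrite coefXn -val_eqE /= => /negPf->; rewrite scale0r.
by rewrite -oactX expg_order oact1 id_lfunE subrr.
Qed.

Lemma minpoly_oactP w : is_minpoly (rho w) (minpoly (rho w)).
Proof.
apply: minpolyP (annihilates_order w).
by rewrite monic_neq0 // monicXnsubC // order_gt0.
Qed.

(** The eigenvalue [1] of an orthogonal map is semisimple.  If [1] were also a
    root of [q = m / (X - 1)], then [q] would send any vector into the image of
    [1 - w], which lies in the moved space, and into its kernel, the fixed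
    space.  These meet in [0], so [q] would annihilate [w], against minimality. *)
Lemma minpoly_oact_simple w (m := minpoly (rho w)) :
  m.[1] = 0 -> (quotX1 m).[1] != 0.
Proof.
move=> m1; have [m_monic m_ann m_min] := minpoly_oactP w.
set q := quotX1 m; apply/eqP => q1.
have mE : m = q * ('X - 1%:P).
  by rewrite /q /quotX1 m1 polyC0 subr0 divpK // dvdp_XsubCl /root m1.
have q0 : q != 0.
  have m0 : m != 0 := monic_neq0 m_monic.
  by apply: contra_neq m0 => q0; rewrite mE q0 mul0r.
have q_ann : annihilates q (rho w).
  move=> v; apply: (@moved_fixed0 w).
    rewrite horner_end_divX1 q1 scale0r addr0 -opprB rpredN.
    exact: coboundary_moved.
  apply/eqP; rewrite -subr_eq0; apply/eqP.
  by rewrite -[RHS](m_ann v) (horner_end_divX1 _ m) m1 scale0r addr0.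
have := m_min q q0 q_ann; rewrite -/m mE size_Mmonic ?monicXsubC //.
by rewrite size_XsubC addn2 ltnn.
Qed.

Definition moved_inv w y :=
  (mu (rho w))^-1 *: horner_end (mbar (rho w)) (rho w) y.

Lemma moved_invD w : {morph moved_inv w : x y / x + y}.
Proof.
move=> x y; rewrite /moved_inv -scalerDr -[x]scale1r horner_end_linear.
by rewrite !scale1r.
Qed.

(** When [p] kills [y] and [p(1) <> 0], the identity
    [p = (X - 1) quotX1 p + p(1)] exhibits a preimage of [y] under [1 - w].  The
    minimal polynomial [m] serves if [m(1) <> 0]; otherwise [m / (X - 1)] does,
    since it sends [y] to a vector both fixed and moved. *)
Lemma moved_invP w y : y \in moved_space rho w ->
  moved_inv w y - rho w (moved_inv w y) = y.
Proof.
move=> y_moved; have [_ m_ann _] := minpoly_oactP w.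
have quotP p : p.[1] != 0 -> horner_end p (rho w) y = 0 ->
    let u := p.[1]^-1 *: horner_end (quotX1 p) (rho w) y in u - rho w u = y.
  move=> p1 /eqP; rewrite horner_end_divX1 addr_eq0 -opprB eqr_opp => /eqP py.
  by rewrite /= linearZ -scalerBr py scalerA mulVf // scale1r.
rewrite /moved_inv /mbar /mu; set m := minpoly _ in m_ann *.
have [m1|m1] := eqVneq m.[1] 0; last exact: quotP.
apply: quotP; first exact: minpoly_oact_simple.
apply: (@moved_fixed0 w).
  rewrite horner_end_divX1 rpredD // ?rpredZ //.
  rewrite -opprB rpredN; exact: coboundary_moved.
apply/eqP; rewrite -subr_eq0; apply/eqP.
by rewrite -[RHS](m_ann y) (horner_end_divX1 _ m) m1 scale0r addr0.
Qed.

End MovedSpace.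

(** * Lattices and their characters *)

Section LatticeDuality.
Variables (R : realType) (V : finNormedModType R) (dot : {dot V for idfun}).
Implicit Types (u v x y z : V) (s : seq V).

Definition separating s (N : V -> Prop) :=
  forall y, N y -> (forall x, x \in s -> dot x y = 0) -> y = 0.

Definition integral_on s (N : V -> Prop) :=
  forall y, N y -> forall x, x \in s -> dot x y \is a Num.int.

Lemma dotMz x y j : dot x (y *~ j) = dot x y *~ j.
Proof.
case: j => n; first exact: linearMnr.
by rewrite NegzE !mulrNz linearNr; congr (- _); exact: linearMnr.
Qed.

Lemma subgroup_Mz (N : V -> Prop) y j :
  N 0 -> (forall x y, N x -> N y -> N (x - y)) -> N y -> N (y *~ j).
Proof.
move=> N0 NB Ny.
have NN x : N x -> N (- x) by move=> ?; rewrite -sub0r; exact: NB.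
have NMn n : N (y *+ n).
  elim: n => // n IH; rewrite mulrS -[y *+ n]opprK; exact/NB/NN.
by case: j => n; [exact: NMn | rewrite NegzE mulrNz; exact/NN/NMn].
Qed.

(** Every character of a discrete subgroup is the restriction of a linear one.
    By induction on the functionals [x] in [s]: a linear representative [z] of
    the character on the subgroup where [dot x] vanishes may be changed along
    [x] without harm, and doing so adjusts its value at an element [y0] whose
    [dot x] is the least positive one; these two pieces generate [N]. *)
Lemma character_linear s (N : V -> Prop) (phi : V -> R[i]) :
    N 0 -> (forall x y, N x -> N y -> N (x - y)) ->
    (forall x, N x -> `|phi x| = 1) ->
    (forall x y, N x -> N y -> phi (x + y) = phi x * phi y) ->
    integral_on s N -> separating s N ->
  exists z, forall y, N y -> phi y = cis (dot z y).
Proof.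
move=> N0 NB phi1 phiD.
have phi0 : phi 0 = 1.
  have phi0_neq0 : phi 0 != 0 by rewrite -normr_eq0 phi1 // oner_eq0.
  by apply: (mulIf phi0_neq0); rewrite -phiD // addr0 mul1r.
elim: s N N0 NB phi1 phiD => [|x s IH] N N0 NB phi1 phiD intN sepN.
  by exists 0 => y /sepN-> //; rewrite linear0r cis0.
have [||||||z zP] := IH (fun y => N y /\ dot x y = 0).
- by rewrite linear0r.
- move=> y y' [Ny xy] [Ny' xy']; rewrite linearBr /= xy xy' subrr.
  by split=> //; apply: NB.
- by move=> y [/phi1].
- by move=> y y' [Ny _] [Ny' _]; exact: phiD.
- by move=> y [/intN yP _] x' x's; apply: yP; rewrite inE x's orbT.
- move=> y [/sepN yP xy] sy; apply: yP => x'.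
  by rewrite inE => /predU1P[->|/sy].
have intxN y : N y -> dot x y \is a Num.int.
  by move=> /intN; apply; rewrite inE eqxx.
pose P n := `[< (0 < n)%N /\ exists2 y, N y & dot x y = n%:R >].
have [exP|noP] := pselect (exists n, P n); last first.
  exists z => y Ny; apply: zP; split=> //.
  have /intrP[k kE] := intxN y Ny.
  apply: contra_notP noP => xy; exists `|k|%N; apply/asboolP.
  have k0 : k != 0 by apply: contra_not_neq xy => k0; rewrite kE k0.
  split; first by rewrite absz_gt0.
  exists (y *~ Num.sg k); first exact: subgroup_Mz.
  by rewrite dotMz kE -mulrzr -intrM mulrC -abszEsg.
have [d /asboolP[d0 [y0 Ny0 xy0]] d_min] := ex_minnP exP.
have dR : d%:R != 0 :> R by rewrite pnatr_eq0 -lt0n.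
have [th thE] := cis_surj (phi1 _ Ny0).
pose z' := z + ((th - dot z y0) / d%:R) *: x.
have z'y0 : dot z' y0 = th.
  by rewrite linearDl linearZl_LR /= xy0 divfK // addrC subrK.
(* E is the subgroup of N on which the adjusted z' works *)
pose E y := N y /\ phi y = cis (dot z' y).
have E0 : E 0 by split=> //; rewrite linear0r cis0.
have EB y y' : E y -> E y' -> E (y - y').
  move=> [Ny yE] [Ny' y'E]; split; first exact: NB.
  apply: (mulIf (cis_neq0 (dot z' y'))).
  by rewrite -{1}y'E -phiD ?subrK -?cisD -?linearDr /= ?subrK //; exact: NB.
exists z' => y Ny; suff [] : E y by [].
have /intrP[k kE] := intxN y Ny.
pose y1 := y0 *~ (k %/ d)%Z.
have E1 : E y1 by apply: subgroup_Mz => //; split=> //; rewrite z'y0.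
have xy1 : dot x (y - y1) = (k %% d)%Z%:~R.
  rewrite linearBr /= dotMz kE xy0 {1}(divz_eq k d) intrD intrM.
  by rewrite -(mulrzr d%:R) mulrC addrC addKr.
have dZ : d%:Z != 0 by rewrite eqz_nat -lt0n.
have r0 : (k %% d)%Z = 0.
  apply/eqP; rewrite -absz_eq0 -leqn0 leqNgt; apply/negP => r_gt0.
  have rE : `|(k %% d)%Z|%N = (k %% d)%Z :> int by rewrite gez0_abs ?modz_ge0.
  have : (d <= `|(k %% d)%Z|)%N.
    apply: d_min; apply/asboolP; split=> //; exists (y - y1).
      by apply: NB => //; case: E1.
    by rewrite xy1 -{1}rE.
  by rewrite -lez_nat rE leNgt ltz_pmod.
have E2 : E (y - y1).
  have Nyy1 : N (y - y1) by apply: NB => //; case: E1.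
  split=> //; rewrite zP; last by split=> //; rewrite xy1 r0.
  by rewrite linearDl linearZl_LR /= xy1 r0 mulr0 addr0.
rewrite -[y](subrK y1) -[y1 in _ + y1]opprK; apply: (EB) => //.
by rewrite -sub0r; apply: EB.
Qed.

(** The endomorphism [z |-> \sum_j dot z b_j *: b_j] is injective, the form
    being definite; its inverse sends [b] to the dual basis. *)
Lemma dual_basis n (b : n.-tuple V) : basis_of {:V} b ->
  exists e : 'I_n -> V, forall i j, dot (e i) (tnth b j) = (i == j)%:R.
Proof.
move=> bV.
pose h z := \sum_(j < n) dot z b`_j *: b`_j.
have h_linear : linear h.
  move=> a x y; rewrite /h scaler_sumr -big_split; apply: eq_bigr => j _ /=.
  by rewrite linearDl linearZl_LR /= scalerDl scalerA.
pose hL : {linear V -> V} :=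
  HB.pack h (GRing.isLinear.Build R V V *:%R h h_linear).
have bfree := basis_free bV.
have hK (i : 'I_n) z : coord b i (h z) = dot z b`_i by rewrite coord_sum_free.
have h_inj : lker (linfun hL) == 0%VS.
  rewrite -subv0; apply/subvP => z; rewrite memv_ker memv0 lfunE /= => /eqP hz0.
  apply/eqP/(dot_eq0 (dot := dot)).
  rewrite {2}(coord_basis bV (memvf z)) linear_sumr big1 // => i _.
  by rewrite linearZr_LR /= -hK hz0 linear0 mulr0.
exists (fun i => (linfun hL)^-1%VF b`_i) => i j.
rewrite (tnth_nth 0) -hK -[h _]/(hL _) -lfunE lker0_lfunVK //.
by rewrite coord_free // eq_sym.
Qed.

Definition in_dual (N : {pred V}) x :=
  forall y, y \in N -> dot x y \is a Num.int.

(** What the construction of representatives requires of a lattice [N] and its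
    dual [N'].  The first clause is discreteness of [N], in the form that
    [character_linear] consumes; unlike a basis, it is equally easy to provide
    for both members of the pair. *)
Definition dual_pair (N N' : {pred V}) :=
  (exists2 s, integral_on s [set` N] & separating s setT) /\
  (forall x, x \in N' <-> in_dual N x).

Variable L : zmodClosed V.
Hypothesis L_lattice : is_lattice L.

Lemma lattice_dual_bases : exists n (b e : 'I_n -> V),
  [/\ forall y, y = \sum_i dot (e i) y *: b i,
      forall i, b i \in L,
      forall i y, y \in L -> dot (e i) y \is a Num.int &
      forall y, (forall i, dot (e i) y \is a Num.int) -> y \in L].
Proof.
have [b bV LE] := L_lattice; have [e eE] := dual_basis bV.
have ebE i (c : 'I__ -> R) : dot (e i) (\sum_j c j *: tnth b j) = c i.
  rewrite linear_sumr (bigD1 i) //= linearZr_LR /= eE eqxx mulr1 big1 ?addr0 //.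
  by move=> j ji; rewrite linearZr_LR /= eE eq_sym (negPf ji) mulr0.
have eK y : y = \sum_i dot (e i) y *: tnth b i.
  have yE := coord_basis bV (memvf y).
  rewrite {1}yE; apply: eq_bigr => i _; rewrite -tnth_nth; congr (_ *: _).
  rewrite {2}yE -(ebE i (fun j => coord b j y)); congr (dot _ _).
  by apply: eq_bigr => j _; rewrite (tnth_nth 0).
have eL y : y \in L <-> forall i, dot (e i) y \is a Num.int.
  split=> [/LE[z ->] i|yint].
    under eq_bigr do rewrite -scaler_int.
    by rewrite ebE intr_int.
  apply/LE; exists (fun i => Num.floor (dot (e i) y)).
  rewrite {1}(eK y); apply: eq_bigr => i _.
  by rewrite -scaler_int floorK.
exists _, (tnth b), e; split=> // [i|i y /eL|y /eL] //.
by apply/eL => j; rewrite eE; case: eqP => _; rewrite ?rpred0 ?rpred1.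
Qed.

Lemma dual_pair_lattice : dual_pair L (dual_lattice dot L).
Proof.
have [n [b [e [eK bL eL _]]]] := lattice_dual_bases.
split; last by move=> x; split=> /asboolP.
exists (map e (enum 'I_n)) => y.
  by move=> yL x /mapP[i _ ->]; exact: eL.
move=> _ ey0; rewrite (eK y) big1 // => i _.
by rewrite ey0 ?scale0r // map_f ?mem_enum.
Qed.

(** A lattice is its own bidual: the coordinates of [x] in a basis are the inner
    products with the dual basis, whose members lie in the dual lattice. *)
Lemma dual_pair_dual_lattice : dual_pair (dual_lattice dot L) L.
Proof.
have [n [b [e [eK bL eL Le]]]] := lattice_dual_bases.
have eL' i : e i \in dual_lattice dot L by apply/asboolP => y; exact: eL.
split.
  exists (map b (enum 'I_n)) => y.
    by move=> /asboolP yL' x /mapP[i _ ->]; rewrite dotC; exact: yL'.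
  move=> _ by0; apply: (dot_eq0 (dot := dot)).
  rewrite {2}(eK y) linear_sumr big1 // => i _.
  by rewrite linearZr_LR /= [dot y _]dotC by0 ?mulr0 // map_f ?mem_enum.
move=> x; split=> [xL y /asboolP yL'|xL'].
  by rewrite dotC; exact: yL'.
by apply: Le => i; rewrite dotC; exact: xL'.
Qed.

End LatticeDuality.

(** * The component group in terms of vectors *)

Section ComponentClasses.
Variables (R : realType) (V : finNormedModType R) (dot : {dot V for idfun}).
Variables (W : finGroupType) (rho : orth_action dot W).
Variables (L : zmodClosed V) (rhoL : preserves rho L) (w : W).
Implicit Types (u v x y : V).

Lemma to_torus0 : to_torus L 0 = 0.
Proof. by have := @to_torusB _ _ L 0 0; rewrite !subrr. Qed.

Definition torus_fixed v := v - rho w v \in L.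

Lemma torus_fixedE v : (to_torus L v \in fixed_pts w rhoL) = torus_fixed v.
Proof.
rewrite unfold_in torus_mapE; last exact: rhoL.
by rewrite /torus_fixed -opprB rpredN; apply/eqP/idP => /to_torus_eq.
Qed.

Lemma torus_fixedD u v : torus_fixed u -> torus_fixed v -> torus_fixed (u + v).
Proof. by rewrite /torus_fixed linearD opprD addrACA => *; rewrite rpredD. Qed.

Lemma torus_fixedN v : torus_fixed v -> torus_fixed (- v).
Proof. by rewrite /torus_fixed linearN -opprD rpredN. Qed.

Lemma torus_fixedB u v : torus_fixed u -> torus_fixed v -> torus_fixed (u - v).
Proof. by move=> ? /torus_fixedN; exact: torus_fixedD. Qed.

Lemma torus_fixed_lattice v : v \in L -> torus_fixed v.
Proof. by move=> vL; rewrite /torus_fixed rpredB ?rhoL. Qed.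

(** The default value [0] is taken when [v + L] is not fixed by [w]. *)
Definition fixed_class v : fixed_torus rhoL w := insubd 0 (to_torus L v).

Definition comp_class v : component_group rhoL w :=
  to_component (fixed_class v).

Lemma val_fixed_class v : torus_fixed v -> val (fixed_class v) = to_torus L v.
Proof. by move=> v_fixed; rewrite insubdK // torus_fixedE. Qed.

Lemma fixed_class_val (p : fixed_torus rhoL w) v :
  val p = to_torus L v -> torus_fixed v /\ p = fixed_class v.
Proof.
move=> pv.
have v_fixed : torus_fixed v by rewrite -torus_fixedE -pv; exact: valP.
by split=> //; apply: val_inj; rewrite val_fixed_class.
Qed.

Lemma comp_class_surj s : exists2 v, torus_fixed v & s = comp_class v.
Proof.
have -> : s = to_component (repr (s : Quotient.quot _)).
  by rewrite /to_component reprK.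
set p := repr _; have [v /fixed_class_val[v_fixed pE]] := to_torusP (val p).
by exists v => //; rewrite /comp_class -pE.
Qed.

Lemma to_componentB (p q : fixed_torus rhoL w) :
  to_component (p - q) = to_component p - to_component q.
Proof.
transitivity (to_component p + to_component (- q)).
  exact (@Quotient.pi_add _ (@identity_component _ _ _ _ _ _ rhoL w) p (- q)).
congr (_ + _).
exact (@Quotient.pi_opp _ (@identity_component _ _ _ _ _ _ rhoL w) q).
Qed.

Lemma to_component_eq0 (p : fixed_torus rhoL w) :
  (to_component p == 0) = (p \in @identity_component _ _ _ _ _ _ rhoL w).
Proof.
have c0 : to_component (0 : fixed_torus rhoL w) = 0.
  by have := to_componentB 0 0; rewrite !subrr.
by rewrite -[p in RHS]subr0 Quotient.idealrBE -[0 in LHS]c0.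
Qed.

Lemma comp_classB u v : torus_fixed u -> torus_fixed v ->
  comp_class (u - v) = comp_class u - comp_class v.
Proof.
move=> uf vf; rewrite /comp_class.
have -> : fixed_class (u - v) = fixed_class u - fixed_class v.
  apply: val_inj; rewrite raddfB /= !val_fixed_class ?to_torusB //.
  exact: torus_fixedB.
exact: to_componentB.
Qed.

Lemma comp_class_lattice v : v \in L -> comp_class v = 0.
Proof.
move=> vL; rewrite /comp_class.
rewrite (_ : fixed_class v = fixed_class v - fixed_class v).
  by rewrite to_componentB subrr.
rewrite subrr; apply: val_inj; rewrite val_fixed_class ?torus_fixed_lattice //=.
by rewrite -to_torus0; apply/to_torus_eq; rewrite subr0.
Qed.

Lemma comp_classD u v : torus_fixed u -> torus_fixed v ->
  comp_class (u + v) = comp_class u + comp_class v.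
Proof.
move=> uf vf; have f0 := torus_fixed_lattice (rpred0 L).
rewrite -[v in LHS]opprK comp_classB ?torus_fixedN // -(sub0r v).
by rewrite comp_classB // (@comp_class_lattice 0) ?rpred0 // sub0r opprK.
Qed.

Lemma representsE x (a : dual R (component_group rhoL w)) :
  represents x a <->
  forall v, torus_fixed v -> a (comp_class v) = cis (dot x v).
Proof.
split=> [ax v v_fixed|ax p v /fixed_class_val[v_fixed ->]]; last exact: ax.
by apply: ax; exact: val_fixed_class.
Qed.

Section Topology.
Hypothesis dotE : forall x, dot x x = `|x| ^+ 2.

Lemma dot_continuous x : continuous (dot x : V -> R).
Proof.
(* polarization reduces this to the continuity of the norm *)
have -> : (dot x : V -> R) = fun y => (`|x + y| ^+ 2 - `|x - y| ^+ 2) / 4.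
  apply/funext => y; rewrite -!dotE (hnormD dot) (hnormB dot) expr0 mul1r /=.
  by field.
have sqr_continuous (f : V -> V) :
    continuous f -> continuous (fun y => `|f y| ^+ 2).
  move=> f_cont y.
  apply: (@continuous_comp _ _ _ (fun z => `|f z|) (fun r => r ^+ 2)).
    by apply: continuous_comp; [exact: f_cont | exact: norm_continuous].
  exact: exprn_continuous.
move=> y; apply: cvgMr_tmp; apply: cvgB.
  apply: (sqr_continuous (fun y => x + y)) => z.
  by apply: cvgD; [exact: cvg_cst | exact: cvg_id].
apply: (sqr_continuous (fun y => x - y)) => z.
by apply: cvgB; [exact: cvg_cst | exact: cvg_id].
Qed.

(** The line through a fixed vector maps to a connected set of fixed points that
    contains the origin. *)
Lemma comp_class_fixed v : rho w v = v -> comp_class v = 0.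
Proof.
move=> v_fix.
have rv_fixed r : torus_fixed (r *: v).
  by rewrite /torus_fixed linearZ /= v_fix subrr rpred0.
apply/eqP; rewrite to_component_eq0; apply/asboolP.
have vE : v = 1 *: v by rewrite scale1r.
rewrite val_fixed_class; last by rewrite vE; exact: rv_fixed.
pose line : R -> torus_top L := (to_torus L : V -> torus_top L) \o *:%R^~ v.
have line_cont : continuous line.
  move=> r; apply: continuous_comp; last exact: to_torus_continuous.
  exact: scalel_continuous.
exists (line @` setT); last by exists 1 => //; rewrite /line /= scale1r.
split; first by exists 0 => //; rewrite /line /= scale0r; exact: to_torus0.
  by move=> _ [r _ <-]; rewrite /= torus_fixedE.
apply: connected_continuous_connected; last exact: continuous_subspaceT.
exact/connected_intervalP.
Qed.

Section Character.
Variable x : V.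
Hypotheses (x_moved : x \in moved_space rho w) (x_int : in_dual dot L x).

(** Every [w^k v] differs from [v] by a lattice vector, and the sum of the
    [w^k v] is fixed, hence orthogonal to [x]. *)
Lemma dot_torsion v : torus_fixed v -> dot x v *+ #[w]%g \is a Num.int.
Proof.
move=> v_fixed.
have orbitP k : v - rho (w ^+ k)%g v \in L.
  elim: k => [|k IH]; first by rewrite expg0 oact1 id_lfunE subrr rpred0.
  rewrite expgS oactM comp_lfunE -(subrK (rho w v) v) -addrA -linearB.
  by rewrite rpredD ?rhoL // subrK.
have sum0 : dot x (\sum_(k < #[w]%g) rho (w ^+ k)%g v) = 0.
  move/mem_orthovP: x_moved; apply; rewrite fixedE.
  rewrite linear_sum; apply/eqP.
  have [n nE] : exists n, #[w]%g = n.+1 by exists #[w]%g.-1; rewrite prednK.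
  rewrite nE big_ord_recr big_ord_recl /= addrC -comp_lfunE -oactM -expgS -nE.
  rewrite expg_order expg0; congr (_ + _).
  by apply: eq_bigr => i _; rewrite -comp_lfunE -oactM -expgS.
rewrite -[_ *+ _]subr0 -sum0 linear_sumr -[X in _ *+ X]card_ord -sumr_const.
rewrite -sumrB; apply: rpred_sum => k _; rewrite -linearBr /=.
exact/x_int/orbitP.
Qed.

(** A trigonometric sum [h] takes only the values [0] and [n], the order of [w],
    at [dot x u] for [u] torus-fixed, the value [n] meaning that [dot x u] is an
    integer.  It descends to a continuous function on the torus, whose image on
    the connected identity component is an interval containing [h 0 = n], thus
    reduced to it. *)
Lemma dot_class0 v : torus_fixed v -> comp_class v = 0 -> dot x v \is a Num.int.
Proof.
move=> v_fixed /eqP; rewrite to_component_eq0 => /asboolP.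
rewrite val_fixed_class //; set C := connected_component _ _ => Cv.
set n := #[w]%g; pose h (r : R) : R := \sum_(j < n) cos (2 * pi * (r *+ j)).
have h_Re r : h r = complex.Re (\sum_(j < n) cis (r *+ j)).
  rewrite /h (big_morph (@complex.Re R) (id1 := 0) (op1 := +%R)) //.
  by move=> -[? ?] [].
have h_int r : r \is a Num.int -> h r = n%:R.
  move=> r_int; rewrite /h -[n in RHS]card_ord -sumr_const.
  apply: eq_bigr => j _.
  have /cis_eq1 : r *+ j \is a Num.int by rewrite rpredMn.
  by rewrite /cis => -[].
have h_nint r : r *+ n \is a Num.int -> r \isn't a Num.int -> h r = 0.
  by move=> rn r_nint; rewrite h_Re sum_cis.
have h_period r k : k \is a Num.int -> h (r + k) = h r.
  move=> k_int; rewrite !h_Re; congr (complex.Re _); apply: eq_bigr => j _.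
  have /cis_eq1 k1 : k *+ j \is a Num.int by rewrite rpredMn.
  by rewrite mulrnDl cisD k1 mulr1.
pose G : torus_top L -> R := fun q => h (dot x (repr (q : Quotient.quot L))).
have GE u : G (to_torus L u) = h (dot x u).
  rewrite /G; set u' := repr _.
  have u'u : u' - u \in L by apply/to_torus_eq; rewrite /to_torus reprK.
  by rewrite -[u'](subrK u) addrC linearDr h_period ?x_int.
have G_cont : continuous G.
  apply/(@quotient_continuous _ (Quotient.quot L)).
  rewrite (_ : _ \o _ = h \o dot x); last by apply/funext => u; exact: GE.
  move=> u; apply: continuous_comp; first exact: dot_continuous.
  exact: continuous_sum_cos.
have GC : is_interval (G @` C).
  apply/connected_intervalP/connected_continuous_connected.
    exact: component_connected.
  exact: continuous_subspaceT.
have C_values q : C q -> G q = 0 \/ G q = n%:R.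
  move=> /connected_component_sub; have [u ->] := to_torusP (q : torus L).
  rewrite /= torus_fixedE GE => /dot_torsion u_tors.
  have [/h_int|/(h_nint _ u_tors)] := boolP (dot x u \is a Num.int); tauto.
have n1 : 1 <= n%:R :> R by rewrite ler1n order_gt0.
apply: contraT => v_nint; have v_tors := dot_torsion v_fixed.
have G_val : (G @` C) 0.
  by exists (to_torus L v) => //; rewrite GE h_nint.
have G_0 : (G @` C) n%:R.
  exists (to_torus L 0); last by rewrite GE linear0r h_int ?rpred0.
  by rewrite to_torus0; apply: connected_component_refl; exact: rpred0.
have [|q Cq Gq] := GC 0 n%:R G_val G_0 (1 / 2); first by lra.
by case: (C_values q Cq); rewrite Gq => ?; lra.
Qed.

Lemma character_of_vector :
  exists a : dual R (component_group rhoL w), represents x a.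
Proof.
have /choice[lift liftP] s : exists v, torus_fixed v /\ s = comp_class v.
  by have [v] := comp_class_surj s; exists v.
have cisE s v : torus_fixed v -> s = comp_class v ->
    cis (dot x (lift s)) = cis (dot x v).
  move=> v_fixed sE; have [ls_fixed lsE] := liftP s.
  rewrite -[lift s](subrK v) linearDr cisD (cis_eq1 _).2 ?mul1r //=.
  apply: dot_class0; first exact: torus_fixedB.
  by rewrite comp_classB // -lsE sE subrr.
have normE s : `|cis (dot x (lift s))| = 1 by exact: normr_cis.
have addE s t : cis (dot x (lift (s + t))) =
    cis (dot x (lift s)) * cis (dot x (lift t)).
  have [ls lsE] := liftP s; have [lt ltE] := liftP t.
  rewrite -cisD -linearDr; apply: cisE; first exact: torus_fixedD.
  by rewrite comp_classD // -lsE -ltE.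
by exists (Dual normE addE); apply/representsE => v v_fixed; exact: cisE.
Qed.

End Character.

End Topology.

End ComponentClasses.

(** * Representing characters by vectors *)

Section Representatives.
Variables (R : realType) (V : finNormedModType R) (dot : {dot V for idfun}).
Variables (W : finGroupType) (rho : orth_action dot W) (w : W).
Variables (L L' : zmodClosed V) (rhoL : preserves rho L).
Hypothesis LL' : dual_pair dot L L'.

Lemma dot_coboundary (u v : V) : dot (u - rho w^-1%g u) v = dot u (v - rho w v).
Proof. by rewrite linearBl linearBr /= oact_adj invgK. Qed.

Lemma moved_inv_fixed y : y \in moved_space rho w -> y \in L ->
  torus_fixed rho L w (moved_inv rho w y).
Proof. by move=> y_moved yL; rewrite /torus_fixed moved_invP. Qed.

(** Each [y] in the moved space and in [L] comes from the fixed point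
    [moved_inv y], so [a] induces a character of these [y], given by some [z].
    Then [z - w^-1 z] represents [a], since [v] and [moved_inv (v - w v)] differ
    by a fixed vector and hence have the same class. *)
Lemma vector_of_character (a : dual R (component_group rhoL w)) :
  exists x, [/\ x \in moved_space rho w, x \in L' & represents x a].
Proof.
have [[s s_int s_sep] L'E] := LL'.
have a0 : a 0 = 1.
  have a0_neq0 : a 0 != 0 by rewrite -normr_eq0 dual_norm oner_eq0.
  by apply: (mulIf a0_neq0); rewrite -dualD addr0 mul1r.
pose N y := y \in moved_space rho w /\ y \in L.
pose phi y := a (comp_class rhoL w (moved_inv rho w y)).
have [||||||z zP] := @character_linear _ _ dot s N phi.
- by split; exact: rpred0.
- by move=> x y [? ?] [? ?]; split; exact: rpredB.
- by move=> y _; exact: dual_norm.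
- move=> x y [xm xL] [ym yL].
  by rewrite /phi moved_invD comp_classD ?dualD //; exact: moved_inv_fixed.
- by move=> y [_ yL]; exact: s_int.
- by move=> y _; exact: s_sep.
have xP : represents (z - rho w^-1%g z) a.
  apply/representsE => v v_fixed; rewrite dot_coboundary -zP; last first.
    by split=> //; exact: coboundary_moved.
  have y_moved := coboundary_moved rho w v.
  have i_fixed := moved_inv_fixed y_moved v_fixed.
  congr (a _); apply/eqP; rewrite -subr_eq0 -comp_classB //.
  apply/eqP/comp_class_fixed => //; apply/eqP.
  rewrite -subr_eq0 linearB opprB addrC [X in _ + X]addrC addrACA.
  by rewrite moved_invP // addrACA subrr addNr addr0.
exists (z - rho w^-1%g z); split=> //; first exact: coboundaryV_moved.
apply/L'E => y yL; apply/cis_eq1.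
rewrite -((representsE _ _).1 xP) ?comp_class_lattice //.
exact: torus_fixed_lattice.
Qed.

Lemma char_repP (a : dual R (component_group rhoL w)) :
  [/\ char_rep L' a \in moved_space rho w, char_rep L' a \in L' &
      represents (char_rep L' a) a].
Proof. exact: xgetPex (vector_of_character a). Qed.

End Representatives.

(** * The closed formula for the pairing *)

Section Pairing.
Variables (R : realType) (V : finNormedModType R) (dot : {dot V for idfun}).
Hypothesis dotE : forall x : V, dot x x = `|x| ^+ 2.
Variables (W : finGroupType) (rho : orth_action dot W) (w : W).
Variables (Gamma : zmodClosed V) (rhoG : preserves rho Gamma).
Hypothesis GammaL : is_lattice Gamma.

Local Notation Gamma' := (dual_lattice dot Gamma).
Local Notation rhoG' := (preserves_dual rhoG).
Local Notation F := (component_group rhoG w).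
Local Notation F' := (component_group rhoG' w).

Lemma chiE (a : dual R F) (b : dual R F') :
  chi a b = a (comp_class rhoG w (moved_inv rho w (char_rep Gamma b))).
Proof.
have [_ _ /representsE xP] := char_repP (dual_pair_lattice dot GammaL) a.
have [ym yL _] := char_repP (dual_pair_dual_lattice dot GammaL) b.
rewrite xP /chi; last exact: moved_inv_fixed.
by congr cis; rewrite linearZr_LR.
Qed.

Lemma torus_fixedV (L : zmodClosed V) v : preserves rho L ->
  torus_fixed rho L w v -> v - rho w^-1%g v \in L.
Proof.
move=> rhoL v_fixed.
have -> : v - rho w^-1%g v = - rho w^-1%g (v - rho w v).
  by rewrite linearB /= oactK opprB.
by rewrite rpredN; exact: rhoL.
Qed.

(** Existence: the character represented by [v - w^-1 v] is a preimage of the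
    evaluation at the class of [v].  Uniqueness: any preimage [a] is determined
    at the class of [u] by its pairing with the character [b] that [u - w u]
    represents.  The chosen representative [y'] of [b] may differ from
    [u - w u], but writing a representative of [a] as [z - w z] turns the two
    values of [a] in question into values of [b], both at the class of
    [- w z]. *)
Lemma pairingE u v : torus_fixed rho Gamma w u -> torus_fixed rho Gamma' w v ->
  pairing (comp_class rhoG w u) (comp_class rhoG' w v) =
    cis (dot (u - rho w u) v).
Proof.
move=> u_fixed v_fixed; rewrite /pairing /psi.
set t := comp_class rhoG' w v.
have psiP a : (forall b, chi a b = b t) ->
    a (comp_class rhoG w u) = cis (dot (u - rho w u) v).
  move=> aP.
  have y_moved := coboundary_moved rho w u.
  have y_int : in_dual dot Gamma' (u - rho w u).
    by apply/(dual_pair_dual_lattice dot GammaL).2.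
  have [b /representsE bP] :=
    character_of_vector rhoG' dotE y_moved y_int.
  rewrite -(bP v) // -/t -aP chiE.
  have [y'm y'L /representsE b'P] :=
    char_repP (dual_pair_dual_lattice dot GammaL) b.
  set y' := char_rep Gamma b in y'm y'L b'P *.
  have [xm xL /representsE xP] := char_repP (dual_pair_lattice dot GammaL) a.
  set x := char_rep _ a in xm xL xP *.
  rewrite !xP //; last exact: moved_inv_fixed.
  pose z := moved_inv rho w x.
  have z_fixed : torus_fixed rho Gamma' w z by exact: moved_inv_fixed.
  have zx : z - rho w z = x := moved_invP xm.
  have xE u' : dot x u' = dot (u' - rho w u') (- rho w z).
    rewrite dotC -zx !linearBl !linearBr !linearNr /= oact_dot.
    by rewrite [RHS]addrC opprK.
  have wz_fixed : torus_fixed rho Gamma' w (- rho w z).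
    apply: torus_fixedN; rewrite /torus_fixed -linearB.
    exact: preserves_dual.
  by rewrite !xE moved_invP // -b'P // bP.
have [|noa] := pselect (exists a : dual R F, forall b, chi a b = b t).
  by move=> /xgetPex/psiP.
exfalso; apply: noa.
have x_moved := coboundaryV_moved rho w v.
have x_int : in_dual dot Gamma (v - rho w^-1%g v).
  apply/(dual_pair_lattice dot GammaL).2; exact: torus_fixedV rhoG' v_fixed.
have [a /representsE aP] := character_of_vector rhoG dotE x_moved x_int.
exists a => b; rewrite chiE.
have [ym yL /representsE bP] :=
  char_repP (dual_pair_dual_lattice dot GammaL) b.
rewrite aP; last exact: moved_inv_fixed.
by rewrite dot_coboundary moved_invP // dotC -bP.
Qed.

End Pairing.

Theorem theorem3 (R : realType) (V : finNormedModType R)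
    (dot : {dot V for idfun}) (dotE : forall x : V, dot x x = `|x| ^+ 2)
    (W : finGroupType) (rho : orth_action dot W)
    (Gamma : zmodClosed V) (GammaL : is_lattice Gamma)
    (rhoG : preserves rho Gamma) (w g : W) (gw : g \in 'C[w]%g)
    (s : component_group rhoG w)
    (t : component_group (preserves_dual rhoG) w) :
  pairing (component_act gw s) (component_act gw t) = pairing s t.
Proof.
have actE (L : zmodClosed V) (rhoL : preserves rho L) v :
    torus_fixed rho L w v -> torus_fixed rho L w (rho g v) /\
    component_act gw (comp_class rhoL w v) = comp_class rhoL w (rho g v).
  move=> v_fixed; rewrite component_actE //.
  have /fixed_class_val[gv_fixed ->] //:
      val (fixed_torus_act gw (fixed_class rhoL w v)) = to_torus L (rho g v).
  by rewrite /= val_fixed_class // torus_mapE //; exact: rhoL.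
have [u u_fixed ->] := comp_class_surj s.
have [v v_fixed ->] := comp_class_surj t.
have [gu_fixed ->] := actE _ rhoG u u_fixed.
have [gv_fixed ->] := actE _ (preserves_dual rhoG) v v_fixed.
rewrite !pairingE //; congr cis.
rewrite -comp_lfunE -oactM -(cent1P gw) oactM comp_lfunE -linearB.
exact: oact_dot.
Qed.
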